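(* Let $T>0$, let $n\ge 1$ and $s_1,s_2\ge 0$ be integers, let $G,A_1,A_2:[0,T]\to M_n(\mathbb{C})$, and let $U(t)=\mathcal{T}\exp\left(\int_0^t dt_1\,G(t_1)\right)$. Let $L_{s_1,s_2}(t)$ be the upper triangular block matrix with $(3s_1+s_2+3)\times(3s_1+s_2+3)$ blocks of size $n\times n$, defined as the sum of the following three contributions (all other blocks being $0$): (i) every diagonal block is $G(t)$; (ii) on the first upper off-diagonal (blocks $(i,i+1)$), the first $s_1+1$ blocks are $0$, and the remaining blocks are, in order, the multiples of $\mathbb{1}_n$ by $(s_1,s_1-1,\dots,0,\,s_1+s_2,s_1+s_2-1,\dots,1)$; (iii) on the $(s_1+1)$-th upper off-diagonal (blocks $(i,i+s_1+1)$), the blocks are, in order, $s_1+1$ repetitions of $A_1(t)$, then $s_1+1$ repetitions of $A_2(t)$, followed by zeros. Then for all $t\in[0,T]$ the upper right block of $\mathcal{T}\exp\left(\int_0^t dt_1\,L_{s_1,s_2}(t_1)\right)$ is $$\mathcal{D}_U(t^{s_1}A_1,t^{s_2}A_2)(t)=U(t)\int_0^t dt_1\int_0^{t_1}dt_2\;t_1^{s_1}t_2^{s_2}\,U^{-1}(t_1)A_1(t_1)U(t_1)\,U^{-1}(t_2)A_2(t_2)U(t_2).$$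
   Context: $M_n(\mathbb{C})$ is the set of $n\times n$ complex matrices and $\mathbb{1}_N$ is the $N\times N$ identity matrix. For $G:[0,T]\to M_N(\mathbb{C})$, the time-ordered exponential $\mathcal{T}\exp\left(\int_0^t dt_1\,G(t_1)\right)$ is notation for the value at $t$ of the unique solution $U$ of the initial value problem $\dot U(t)=G(t)U(t)$, $U(0)=\mathbb{1}_N$ on $[0,T]$. The convention $t^0=1$ is used. Standing assumption: all generators are regular enough that the relevant initial value problems have unique solutions and the integrals make sense (e.g. piecewise continuous on $[0,T]$). *)

(* Defs.v *)
(* The complex numbers are R[i] for an arbitrary model R of the reals. *)
From mathcomp Require Import all_boot all_order all_algebra.
From mathcomp Require Import all_classical all_reals all_analysis.
From mathcomp Require Export complex.
Set Implicit Arguments.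
Unset Strict Implicit.
Unset Printing Implicit Defensive.
Import Order.TTheory GRing.Theory Num.Theory.
Import numFieldNormedType.Exports.
Local Open Scope classical_set_scope.
Local Open Scope ring_scope.

(* R[i] has no canonical normed-space structure over R, so the calculus of
   functions of a real variable with values in complex matrices goes through
   the real and imaginary parts of the entries. *)
Definition reim_entries (R : realType) (m n : nat) (P : (R -> R) -> Prop)
    (F : R -> 'M[R[i]]_(m, n)) : Prop :=
  forall i j, P (fun t => complex.Re (F t i j)) /\
              P (fun t => complex.Im (F t i j)).

(* Functions on [a, b] are total functions on R constrained only on [a, b]. *)
Definition piecewise_continuous (R : realType) (a b : R) (f : R -> R) : Prop :=
  [/\ exists s : seq R, forall t, t \in `]a, b[ -> t \notin s ->
        {for t, continuous f},
      forall t, t \in `[a, b[ -> cvg (f x @[x --> t^'+]) &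
      forall t, t \in `]a, b] -> cvg (f x @[x --> t^'-])].

Definition mx_piecewise_continuous (R : realType) (m n : nat) (a b : R)
    (F : R -> 'M[R[i]]_(m, n)) : Prop :=
  reim_entries (piecewise_continuous a b) F.

Definition mx_is_derive (R : realType) (m n : nat) (t : R)
    (F : R -> 'M[R[i]]_(m, n)) (D : 'M[R[i]]_(m, n)) : Prop :=
  forall i j,
    is_derive t 1 (fun x => complex.Re (F x i j)) (complex.Re (D i j)) /\
    is_derive t 1 (fun x => complex.Im (F x i j)) (complex.Im (D i j)).

(* U is a time-ordered exponential of G on [0, T]: U' = G U, U(0) = 1.  As
   usual for a piecewise continuous G, a solution is a continuous function
   satisfying the equation at all but finitely many points; the end points,
   where only one-sided derivatives make sense, count among the exceptions.
   For such G this determines U uniquely on [0, T]. *)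
Definition is_texp (R : realType) (m : nat) (T : R)
    (G U : R -> 'M[R[i]]_m) : Prop :=
  [/\ reim_entries (fun f => {within `[0, T], continuous f}) U,
      U 0 = 1%:M &
      exists s : seq R, forall t, t \in `]0, T[ -> t \notin s ->
        mx_is_derive t U (G t *m U t)].

Definition cintegral (R : realType) (a b : R) (f : R -> R[i]) : R[i] :=
  Complex (\int[lebesgue_measure]_(x in `[a, b]) complex.Re (f x))
          (\int[lebesgue_measure]_(x in `[a, b]) complex.Im (f x)).

Definition mx_integral (R : realType) (m n : nat) (a b : R)
    (F : R -> 'M[R[i]]_(m, n)) : 'M[R[i]]_(m, n) :=
  \matrix_(i, j) cintegral a b (fun t => F t i j).

(* = 3 * s1 + s2 + 3, written as a successor so that ord0 and ord_max exist. *)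
Definition nblocks (s1 s2 : nat) : nat := (3 * s1 + s2 + 2).+1.

(* 0, ..., 0 (s1 + 1 times), s1, s1 - 1, ..., 0, s1 + s2, ..., 1 *)
Definition offdiag_coefs (s1 s2 : nat) : seq nat :=
  nseq s1.+1 0%N ++ rev (iota 0 s1.+1) ++ rev (iota 1 (s1 + s2)).

(* Block indices start at 0; past the end of the second list, nth returns the
   zero matrix. *)
Definition L_block (R : realType) (n s1 s2 : nat) (G A1 A2 : 'M[R[i]]_n)
    (i j : 'I_(nblocks s1 s2)) : 'M[R[i]]_n :=
  (if j == i :> nat then G else 0)
  + (if j == i.+1 :> nat then ((nth 0%N (offdiag_coefs s1 s2) i)%:R)%:M else 0)
  + (if j == (i + s1.+1)%N :> nat
     then nth 0 (nseq s1.+1 A1 ++ nseq s1.+1 A2) i else 0).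

Definition L_gen (R : realType) (n s1 s2 : nat) (G A1 A2 : R -> 'M[R[i]]_n)
    (t : R) : 'M[R[i]]_(\sum_(i < nblocks s1 s2) n) :=
  \mxblock_(i < nblocks s1 s2, j < nblocks s1 s2)
    L_block (G t) (A1 t) (A2 t) i j.

(* Main.v *)
Require Import Defs.
From mathcomp Require Import all_boot all_order all_algebra.
From mathcomp Require Import all_classical all_reals all_analysis.
From mathcomp Require Import ring lra zify measurable_realfun.
Set Implicit Arguments.
Unset Strict Implicit.
Unset Printing Implicit Defensive.
Import Order.TTheory GRing.Theory Num.Theory.
Import numFieldNormedType.Exports.
Local Open Scope classical_set_scope.
Local Open Scope ring_scope.

(* Only the last block column X_j of V matters.  Since V' = L V, it satisfies
   X_j' = G X_j + c_j X_{j+1} + a_j X_{j+s1+1}, with X_j(0) = 0 except for the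
   last block, X_{N-1}(0) = 1.  With I2 the integral of t^s2 U^-1 A2 U, this
   triangular system is solved from the bottom up by
     X_{N-1-d} = t^d U        (d <= s1 + s2),
     X_{2 s1+1-d} = t^d U I2  (d <= s1),
   and X_0 is then given by variation of constants.  Uniqueness for X' = G X + B
   and invertibility of U both follow from Gronwall's inequality applied, in the
   two time directions, to the squared norm of a solution of X' = G X. *)

(** * Piecewise continuous functions *)

Lemma piecewise_continuous_cst (R : realType) (a b c : R) :
  piecewise_continuous a b (fun=> c).
Proof.
split=> [|t _|t _]; [|exact: is_cvg_cst..].
by exists [::] => t _ _; exact: cst_continuous.
Qed.

Lemma piecewise_continuousD (R : realType) (a b : R) (f g : R -> R) :
  piecewise_continuous a b f -> piecewise_continuous a b g ->
  piecewise_continuous a b (fun t => f t + g t).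
Proof.
move=> [[s cf] fr fl] [[s' cg] gr gl]; split=> [|t tab|t tab].
- exists (s ++ s') => t tab; rewrite mem_cat negb_or => /andP[ts ts'].
  by apply: continuousD; [exact: cf | exact: cg].
- by apply: is_cvgD; [exact: fr | exact: gr].
- by apply: is_cvgD; [exact: fl | exact: gl].
Qed.

Lemma piecewise_continuousM (R : realType) (a b : R) (f g : R -> R) :
  piecewise_continuous a b f -> piecewise_continuous a b g ->
  piecewise_continuous a b (fun t => f t * g t).
Proof.
move=> [[s cf] fr fl] [[s' cg] gr gl]; split=> [|t tab|t tab].
- exists (s ++ s') => t tab; rewrite mem_cat negb_or => /andP[ts ts'].
  by apply: continuousM; [exact: cf | exact: cg].
- by apply: is_cvgM; [exact: fr | exact: gr].
- by apply: is_cvgM; [exact: fl | exact: gl].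
Qed.

Lemma within_continuous_piecewise (R : realType) (a b : R) (f : R -> R) :
  a < b -> {within `[a, b], continuous f} -> piecewise_continuous a b f.
Proof.
move=> ab /(continuous_within_itvP f ab)[cf fa fb].
split=> [|t|t].
- by exists [::] => t tab _; apply: cf.
- rewrite in_itv /= le_eqVlt => /andP[/predU1P[<-|at_] tb].
    by apply/cvg_ex; exists (f a).
  apply/cvg_ex; exists (f t); apply: cvg_at_right_filter; apply: cf.
  by rewrite in_itv /= at_.
- rewrite in_itv /= le_eqVlt => /andP[at_ /predU1P[->|tb]].
    by apply/cvg_ex; exists (f b).
  apply/cvg_ex; exists (f t); apply: cvg_at_left_filter; apply: cf.
  by rewrite in_itv /= at_.
Qed.

(** The one-sided limits bound [f] on each side of every point, and compactness of the segment makes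
    the bound uniform. *)
Lemma piecewise_continuous_bounded (R : realType) (a b : R) (f : R -> R) :
  piecewise_continuous a b f ->
  exists M, forall t, t \in `[a, b] -> `|f t| <= M.
Proof.
move=> [_ fr fl].
have cv (F : set_system R) : ProperFilter F -> cvg (f x @[x --> F]) ->
    exists M, \forall x \near F, `|f x| <= M.
  move=> FF /cvg_ex[l fxl]; exists (`|l| + 1).
  move/cvgrPdist_le : fxl => /(_ 1 ltr01); apply: filterS => x.
  by move=> xl; rewrite -[f x](subKr l) (le_trans (ler_normB _ _))// lerD2l.
have loc t : t \in `[a, b] ->
    exists M, \forall x \near t, x \in `[a, b] -> `|f x| <= M.
  rewrite in_itv /= => /andP[at_ tb].
  have [Mr] : exists M, \forall x \near t^'+, x \in `[a, b] -> `|f x| <= M.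
    move: tb; rewrite le_eqVlt => /predU1P[->|tb].
      (* No right limit is available at [b], but points to the right of [b] lie outside the segment,
         so any bound works. *)
      exists 0; near=> x; rewrite in_itv /= => /andP[_].
      by rewrite leNgt; have -> : b < x by near: x; exact: nbhs_right_gt.
    have frt : cvg (f x @[x --> t^'+]) by apply: fr; rewrite in_itv /= at_.
    have [M HM] := cv _ _ frt.
    by exists M; apply: filterS HM.
  rewrite near_withinE => Hr.
  have [Ml] : exists M, \forall x \near t^'-, x \in `[a, b] -> `|f x| <= M.
    move: at_; rewrite le_eqVlt => /predU1P[<-|at_].
      exists 0; near=> x; rewrite in_itv /= => /andP[+ _].
      by rewrite leNgt; have -> : x < a by near: x; exact: nbhs_left_lt.
    have flt : cvg (f x @[x --> t^'-]) by apply: fl; rewrite in_itv /= at_.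
    have [M HM] := cv _ _ flt.
    by exists M; apply: filterS HM.
  rewrite near_withinE => Hl.
  (* The punctured one-sided neighbourhoods miss [t] itself, hence the term in [f t]. The norms keep
     every summand nonnegative. *)
  exists (`|f t| + `|Mr| + `|Ml|).
  near=> x => xab.
  have hr : t < x -> x \in `[a, b] -> `|f x| <= Mr by near: x.
  have hl : x < t -> x \in `[a, b] -> `|f x| <= Ml by near: x.
  case: (ltgtP x t) => xt; last by rewrite xt -addrA lerDl addr_ge0.
  - rewrite (le_trans (hl xt xab))// (le_trans (ler_norm _))//.
    by rewrite lerDr addr_ge0.
  - rewrite (le_trans (hr xt xab))// (le_trans (ler_norm _))//.
    by rewrite -addrA addrCA lerDl addr_ge0.
(* Compactness is used in its near-covering form, with the bound [M] tending to infinity as the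
   parameter. *)
have /compact_near_coveringP cab := @segment_compact R a b.
have [|M0 [_ HM]] :=
    cab R (pinfty_nbhs R) (fun M x => x \in `[a, b] -> `|f x| <= M) _.
  move=> t tab; have [M HM] := loc t tab.
  exists ([set x | x \in `[a, b] -> `|f x| <= M], [set N | M <= N]) => /=.
    by split=> //; exact: nbhs_pinfty_ge (num_real M).
  by move=> [x N] /= [Hx MN] xab; exact: (le_trans (Hx xab)).
exists (M0 + 1) => t tab.
by apply: (HM (M0 + 1)) => //; rewrite ltrDl.
Unshelve. all: by end_near. Qed.

(** A bounded measurable function on a set of finite measure is integrable. For measurability the
    segment is covered by an open set where [f] is continuous and a finite set, on which every
    function is measurable. *)
Lemma piecewise_continuous_integrable (R : realType) (a b : R) (f : R -> R) :
  piecewise_continuous a b f ->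
  lebesgue_measure.-integrable `[a, b] (EFin \o f).
Proof.
move=> pf; have [M HM] := piecewise_continuous_bounded pf.
apply: measurable_bounded_integrable => //=.
- by rewrite lebesgue_measure_itv /=; case: ifPn => // _; rewrite -EFinB ltry.
- have [[s cf] _ _] := pf.
  pose D : set R := `]a, b[ `\` [set` s].
  have oD : open D.
    rewrite /D setDE; apply: openI; first exact: interval_open.
    apply: closed_openC.
    have /accessible_finite_set_closed := hausdorff_accessible (@Rhausdorff R).
    by apply; exact: finite_seq.
  have mD : measurable_fun D f.
    apply: open_continuous_measurable_fun => // t.
    by rewrite inE => -[tab /negP ts]; exact: cf.
  pose E : set R := [set` a :: b :: s].
  have ms (l : seq R) : measurable [set` l].
    by apply: countable_measurable => //; exact/finite_set_countable/finite_seq.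
  have mf : measurable_fun E f.
    rewrite /E; elim: (a :: b :: s) => [|x l IH].
      by rewrite set_nil; exact: measurable_fun_set0.
    rewrite [X in measurable_fun X](_ : _ = [set x] `|` [set` l]); last first.
      apply/seteqP; split=> y /=; rewrite inE.
        by case/predU1P; [left|right].
      by case=> ->; rewrite ?eqxx ?orbT.
    apply/measurable_funU => //; split=> //; exact: measurable_fun_set1.
  apply: (@measurable_funS _ _ _ _ (D `|` E)).
  + by apply: measurableU; [exact: open_measurable|exact: ms].
  + move=> t; rewrite /= in_itv /= => /andP[ta tb].
    have [tE|tE] := boolP (t \in a :: b :: s); first by right.
    move: tE; rewrite !inE !negb_or => /and3P[nta ntb ts]; left; split.
      by rewrite /= in_itv /= !lt_neqAle eq_sym nta ta ntb tb.
    exact/negP.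
  + by apply/measurable_funU => //; [exact: open_measurable|exact: ms].
exists M; split; first exact: num_real.
by move=> x Mx t /= tab; exact: le_trans (HM _ tab) (ltW Mx).
Qed.

(** * Differential inequalities with finitely many exceptional points *)

Lemma is_derive1D (R : realType) (f g : R -> R) (t df dg : R) :
  is_derive t 1 f df -> is_derive t 1 g dg ->
  is_derive t 1 (fun x => f x + g x) (df + dg).
Proof. by move=> Df Dg; exact: (is_deriveD Df Dg). Qed.

Lemma is_derive1N (R : realType) (f : R -> R) (t df : R) :
  is_derive t 1 f df -> is_derive t 1 (fun x => - f x) (- df).
Proof. by move=> Df; exact: (is_deriveN Df). Qed.

Lemma is_derive1M (R : realType) (f g : R -> R) (t df dg : R) :
  is_derive t 1 f df -> is_derive t 1 g dg ->
  is_derive t 1 (fun x => f x * g x) (df * g t + f t * dg).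
Proof.
move=> Df Dg; have D := is_deriveM Df Dg.
by apply: is_derive_eq; rewrite addrC /GRing.scale /= [g t * _]mulrC.
Qed.

Lemma within_continuousM (R : realType) (A : set R) (f g : R -> R) :
  {within A, continuous f} -> {within A, continuous g} ->
  {within A, continuous (fun t => f t * g t)}.
Proof.
by move=> cf cg x; apply: (@continuousM R (subspace A)); [exact: cf|exact: cg].
Qed.

(** Induction on the exceptional points: one inside the interval splits it in two, and the two
    inequalities chain there because [f] is continuous. *)
Lemma le_of_derive_ge0 (R : realType) (s : seq R) (a b : R) (f df : R -> R) :
  a <= b -> {within `[a, b], continuous f} ->
  (forall t, t \in `]a, b[ -> t \notin s ->
    is_derive t 1 f (df t) /\ 0 <= df t) ->
  f a <= f b.
Proof.
elim: s a b => [|x s IH] a b ab cf dfE.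
  (* The mean value point may be an end point, where nothing is known about [df]; replacing [df] by
     0 there keeps the sign. *)
  have [t|c cab E] := @MVT_segment R f
    (fun t => if t \in `]a, b[ then df t else 0) a b ab _ cf.
    by move=> tab; rewrite tab; have [] := dfE t tab isT.
  rewrite -subr_ge0 E mulr_ge0 ?subr_ge0//.
  by case: ifP => // cab'; have [] := dfE c cab' isT.
have [xab|xab] := boolP (x \in `]a, b[); last first.
  apply: IH => // t tab ts; apply: dfE => //; rewrite inE negb_or ts andbT.
  by apply: contraNneq xab => <-.
have := xab; rewrite in_itv /= => /andP[ax xb].
have sub c d : a <= c -> d <= b -> {within `[c, d], continuous f}.
  move=> ac db; apply: continuous_subspaceW cf.
  by apply: subset_itv; rewrite bnd_simp.
apply: (@le_trans _ _ (f x)).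
- apply: IH; [exact: ltW|by apply: sub => //; exact: ltW|].
  move=> t; rewrite in_itv /= => /andP[at_ tx] ts; apply: dfE.
    by rewrite in_itv /= at_ (lt_trans tx).
  by rewrite inE negb_or ts lt_eqF.
- apply: IH; [exact: ltW|by apply: sub => //; exact: ltW|].
  move=> t; rewrite in_itv /= => /andP[xt tb] ts; apply: dfE.
    by rewrite in_itv /= tb (lt_trans ax).
  by rewrite inE negb_or ts gt_eqF.
Qed.

Lemma continuous_expRM (R : realType) (k : R) :
  continuous (fun t : R => expR (k * t)).
Proof.
move=> t; apply: continuous_comp; last exact: continuous_expR.
by apply: continuousM; [exact: cst_continuous|exact: id].
Qed.

Lemma is_derive_expRM (R : realType) (k t : R) :
  is_derive t 1 (fun x : R => expR (k * x)) (k * expR (k * t)).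
Proof.
have -> : (fun x : R => expR (k * x)) = expR \o (k \*: id) by [].
by apply: is_derive_eq; rewrite /= /GRing.scale /= mulr1 mulrC.
Qed.

(* Both [expR (k * t) * N t] and [- expR (- k * t) * N t] are nondecreasing. *)
Lemma gronwall_eq0 (R : realType) (T k : R) (s : seq R) (N dN : R -> R) :
  {within `[0, T], continuous N} -> (forall t, 0 <= N t) ->
  (forall t, t \in `]0, T[ -> t \notin s ->
    is_derive t 1 N (dN t) /\ `|dN t| <= k * N t) ->
  forall t, t \in `[0, T] -> (N 0 = 0 <-> N t = 0).
Proof.
move=> cN N0 dNE t; rewrite in_itv /= => /andP[t0 tT].
have cont (c : R) :
    {within `[0, t], continuous (fun x => expR (c * x) * N x)}.
  apply: (@continuous_subspaceW _ _ _ `[0, T]).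
    by apply: subset_itv; rewrite bnd_simp.
  by apply: within_continuousM => //; exact/continuous_subspaceT/continuous_expRM.
have der (c x : R) : x \in `]0, t[ -> x \notin s ->
    is_derive x 1 (fun x => expR (c * x) * N x)
      (expR (c * x) * (c * N x + dN x)) /\ `|dN x| <= k * N x.
  rewrite in_itv /= => /andP[x0 xt] xs.
  have [|dNx bN] := dNE x _ xs; first by rewrite in_itv /= x0 (lt_le_trans xt).
  have dE := is_derive_expRM c x.
  split=> //; apply: (is_derive_eq (is_derive1M dE dNx)).
  by ring.
have inc : expR (k * 0) * N 0 <= expR (k * t) * N t.
  apply: (le_of_derive_ge0 t0 (cont k)) => x xt xs.
  have [D bN] := der k x xt xs; split; first exact: D.
  by rewrite mulr_ge0 ?expR_ge0//; move: bN; rewrite ler_norml; lra.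
have dec : - (expR (- k * 0) * N 0) <= - (expR (- k * t) * N t).
  apply: (@le_of_derive_ge0 R s 0 t (fun x => - (expR (- k * x) * N x))
    (fun x => - (expR (- k * x) * (- k * N x + dN x))) t0).
    by move=> x; exact: (continuousN (cont (- k) x)).
  move=> x xt xs; have [D bN] := der (- k) x xt xs.
  split; first exact: is_derive1N.
  by rewrite -mulrN mulr_ge0 ?expR_ge0//; move: bN; rewrite ler_norml; lra.
move: inc dec; rewrite lerN2 !mulr0 expR0 !mul1r => inc dec.
(* [dec] carries the vanishing of [N] forward from 0 to [t], [inc] carries it back. *)
split=> [NE|NE].
- move: dec; rewrite NE pmulr_rle0 ?expR_gt0// => dec.
  by apply/le_anti; rewrite dec N0.
- move: inc; rewrite NE mulr0 => inc.
  by apply/le_anti; rewrite inc N0.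
Qed.

Lemma piecewise_continuous_FTC1 (R : realType) (T : R) (f : R -> R) : 0 < T ->
  piecewise_continuous 0 T f ->
  let F t := \int[lebesgue_measure]_(x in `[0, t]) f x in
  [/\ {within `[0, T], continuous F}, F 0 = 0 &
      exists s : seq R, forall t, t \in `]0, T[ -> t \notin s ->
        is_derive t 1 F (f t)].
Proof.
move=> T0 pf F.
have intf := piecewise_continuous_integrable pf.
split.
- exact: (parameterized_integral_continuous (ltW T0) intf).
- by rewrite /F set_itv1 Rintegral_set1.
- have [[s cf] _ _] := pf; exists s => t tT ts.
  have := tT; rewrite in_itv /= => /andP[t0 tT'].
  have [D E] := continuous_FTC1_closed tT' intf t0 (cf _ tT ts).
  by apply: (DeriveDef D); rewrite -derive1E E.
Qed.

(** * Real and imaginary parts of complex matrix functions *)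

Lemma ReD (R : realType) (x y : R[i]) :
  complex.Re (x + y) = complex.Re x + complex.Re y.
Proof. by case: x y => [a b] [c d]. Qed.

Lemma ImD (R : realType) (x y : R[i]) :
  complex.Im (x + y) = complex.Im x + complex.Im y.
Proof. by case: x y => [a b] [c d]. Qed.

(** The difference is written with a factor [- 1] so that only constants, sums and products occur,
    as in [subalgebra] below. *)
Lemma ReM (R : realType) (x y : R[i]) : complex.Re (x * y) =
  complex.Re x * complex.Re y + - 1 * (complex.Im x * complex.Im y).
Proof. by case: x y => [a b] [c d]; rewrite mulN1r. Qed.

Lemma ImM (R : realType) (x y : R[i]) : complex.Im (x * y) =
  complex.Re x * complex.Im y + complex.Im x * complex.Re y.
Proof. by case: x y => [a b] [c d]. Qed.

Lemma Re_sum (R : realType) (I : Type) (r : seq I) (F : I -> R[i]) :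
  complex.Re (\sum_(i <- r) F i) = \sum_(i <- r) complex.Re (F i).
Proof. by apply: (big_morph _ (@ReD R)). Qed.

Lemma Im_sum (R : realType) (I : Type) (r : seq I) (F : I -> R[i]) :
  complex.Im (\sum_(i <- r) F i) = \sum_(i <- r) complex.Im (F i).
Proof. by apply: (big_morph _ (@ImD R)). Qed.

(** * Stability of function classes under matrix operations, treated at once for continuity on a set
    and piecewise continuity *)

Definition subalgebra (R : realType) (P : (R -> R) -> Prop) : Prop :=
  [/\ forall c, P (fun=> c),
      forall f g, P f -> P g -> P (fun t => f t + g t) &
      forall f g, P f -> P g -> P (fun t => f t * g t)].

Definition reim (R : realType) (P : (R -> R) -> Prop) (f : R -> R[i]) : Prop :=
  P (fun t => complex.Re (f t)) /\ P (fun t => complex.Im (f t)).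

Section Subalgebra.
Variables (R : realType) (P : (R -> R) -> Prop).
Hypothesis algP : subalgebra P.

Lemma reim_cst (c : R[i]) : reim P (fun=> c).
Proof. by case: algP => cst _ _; split; apply: cst. Qed.

Lemma reim_real (f : R -> R) : P f -> reim P (fun t => (f t)%:C%C).
Proof. by case: algP => cst _ _ Pf; split => //=; exact: cst. Qed.

Lemma reimD (f g : R -> R[i]) :
  reim P f -> reim P g -> reim P (fun t => f t + g t).
Proof.
case: algP => _ add _ [f1 f2] [g1 g2]; split.
- by under eq_fun do rewrite ReD; apply: add.
- by under eq_fun do rewrite ImD; apply: add.
Qed.

Lemma reimM (f g : R -> R[i]) :
  reim P f -> reim P g -> reim P (fun t => f t * g t).
Proof.
case: algP => cst add mul [f1 f2] [g1 g2]; split.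
- under eq_fun do rewrite ReM.
  exact: (add _ _ (mul _ _ f1 g1) (mul _ _ (cst (- 1)) (mul _ _ f2 g2))).
- by under eq_fun do rewrite ImM; exact: (add _ _ (mul _ _ f1 g2) (mul _ _ f2 g1)).
Qed.

Lemma reim_sum (I : Type) (r : seq I) (F : I -> R -> R[i]) :
  (forall i, reim P (F i)) -> reim P (fun t => \sum_(i <- r) F i t).
Proof.
move=> PF; elim: r => [|i r IH].
  by under eq_fun do rewrite big_nil; exact: reim_cst.
by under eq_fun do rewrite big_cons; exact: reimD.
Qed.

Lemma reim_prod (I : Type) (r : seq I) (F : I -> R -> R[i]) :
  (forall i, reim P (F i)) -> reim P (fun t => \prod_(i <- r) F i t).
Proof.
move=> PF; elim: r => [|i r IH].
  by under eq_fun do rewrite big_nil; exact: reim_cst.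
by under eq_fun do rewrite big_cons; exact: reimM.
Qed.

Lemma reim_entries_cst (m n : nat) (A : 'M[R[i]]_(m, n)) :
  reim_entries P (fun=> A).
Proof. by move=> i j; exact: (reim_cst (A i j)). Qed.

Lemma reim_entriesD (m n : nat) (F F' : R -> 'M[R[i]]_(m, n)) :
  reim_entries P F -> reim_entries P F' ->
  reim_entries P (fun t => F t + F' t).
Proof.
move=> PF PF' i j; suff: reim P (fun t => (F t + F' t) i j) by [].
by under eq_fun do rewrite mxE; apply: reimD; [exact: PF|exact: PF'].
Qed.

Lemma reim_entriesZ (m n : nat) (f : R -> R[i]) (F : R -> 'M[R[i]]_(m, n)) :
  reim P f -> reim_entries P F -> reim_entries P (fun t => f t *: F t).
Proof.
move=> Pf PF i j; suff: reim P (fun t => (f t *: F t) i j) by [].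
by under eq_fun do rewrite mxE; apply: reimM => //; exact: PF.
Qed.

Lemma reim_entriesM (m n p : nat) (F : R -> 'M[R[i]]_(m, n))
    (F' : R -> 'M[R[i]]_(n, p)) :
  reim_entries P F -> reim_entries P F' ->
  reim_entries P (fun t => F t *m F' t).
Proof.
move=> PF PF' i j; suff: reim P (fun t => (F t *m F' t) i j) by [].
under eq_fun do rewrite mxE; apply: reim_sum => k.
by apply: reimM; [exact: PF|exact: PF'].
Qed.

Lemma reim_det (n : nat) (F : R -> 'M[R[i]]_n) :
  reim_entries P F -> reim P (fun t => \det (F t)).
Proof.
move=> PF; apply: reim_sum => s; apply: reimM; first exact: reim_cst.
by apply: reim_prod => i; exact: PF.
Qed.

Lemma reim_entries_adj (n : nat) (F : R -> 'M[R[i]]_n) :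
  reim_entries P F -> reim_entries P (fun t => \adj (F t)).
Proof.
move=> PF i j; suff: reim P (fun t => (\adj (F t)) i j) by [].
under eq_fun do rewrite mxE /cofactor.
apply: reimM; first exact: reim_cst.
apply: reim_det => k l.
suff: reim P (fun t => row' j (col' i (F t)) k l) by [].
by under eq_fun do rewrite !mxE; exact: PF.
Qed.

End Subalgebra.

Lemma subalgebra_within (R : realType) (A : set R) :
  subalgebra (fun f : R -> R => {within A, continuous f}).
Proof.
split=> [c|f g|f g]; last exact: within_continuousM.
- by apply: continuous_subspaceT => x; exact: cst_continuous.
- exact: within_continuousD.
Qed.

Lemma subalgebra_piecewise (R : realType) (a b : R) :
  subalgebra (@piecewise_continuous R a b).
Proof.
by split; [exact: piecewise_continuous_cst|exact: piecewise_continuousD|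
  exact: piecewise_continuousM].
Qed.

Lemma within_continuous_eq (R : realType) (A : set R) (f g : R -> R) :
  {in A, f =1 g} -> {within A, continuous f} -> {within A, continuous g}.
Proof. by move=> fg cf; exact: subspace_eq_continuous cf. Qed.

(** The inverse of x + iy is (x - iy) / (x^2 + y^2), whose denominator [N] does not vanish on the
    segment. *)
Lemma reim_within_inv (R : realType) (a b : R) (f : R -> R[i]) :
  (forall t, t \in `[a, b] -> f t != 0) ->
  reim (fun f => {within `[a, b], continuous f}) f ->
  reim (fun f => {within `[a, b], continuous f}) (fun t => (f t)^-1).
Proof.
move=> f0 [f1 f2].
pose N t := complex.Re (f t) * complex.Re (f t)
  + complex.Im (f t) * complex.Im (f t).
have [cst add mul] := @subalgebra_within R `[a, b].
have cN : {within `[a, b], continuous N} by apply: add; exact: mul.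
have N0 t : t \in `[a, b] -> N t != 0.
  move=> /f0; apply: contra; rewrite /N -!expr2 paddr_eq0 ?sqr_ge0// !sqrf_eq0.
  by rewrite eq_complex.
have cV : {within `[a, b], continuous (fun t => (N t)^-1)}.
  apply/subspace_continuousP => t tab.
  apply: cvgV; first exact: N0.
  by move/subspace_continuousP : cN => /(_ t tab).
have -> : (fun t => (f t)^-1) = fun t =>
    Complex (complex.Re (f t) * (N t)^-1) (- 1 * (complex.Im (f t) * (N t)^-1)).
  apply/funext => t; rewrite /N -!expr2; case: (f t) => x y /=.
  by rewrite mulN1r.
split=> /=; first exact: (mul _ _ f1 cV).
exact: (mul _ _ (cst (- 1)) (mul _ _ f2 cV)).
Qed.

(** Cramer's formula: the adjugate divided by the determinant is continuous, and it agrees with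
    [invmx] on the segment, where [F] is invertible. *)
Lemma reim_entries_within_invmx (R : realType) (a b : R) (n : nat)
    (F : R -> 'M[R[i]]_n) :
  (forall t, t \in `[a, b] -> F t \in unitmx) ->
  reim_entries (fun f => {within `[a, b], continuous f}) F ->
  reim_entries (fun f => {within `[a, b], continuous f}) (fun t => invmx (F t)).
Proof.
move=> uF cF.
have algW := @subalgebra_within R `[a, b].
have cdet := reim_det algW cF.
have := reim_entriesZ algW (reim_within_inv _ cdet) (reim_entries_adj algW cF).
move=> H i j; have [|H1 H2] := H _ i j.
  by move=> t /uF; rewrite unitmxE unitfE.
split; [apply: within_continuous_eq H1|apply: within_continuous_eq H2] => t;
  by rewrite inE => /= tab; rewrite /invmx uF.
Qed.

(** * Derivatives of complex-valued and matrix-valued functions *)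

Definition cderive (R : realType) (t : R) (f : R -> R[i]) (d : R[i]) : Prop :=
  is_derive t 1 (fun x => complex.Re (f x)) (complex.Re d) /\
  is_derive t 1 (fun x => complex.Im (f x)) (complex.Im d).

Section ComplexDerivative.
Variables (R : realType) (t : R).

Lemma cderive_cst (c : R[i]) : cderive t (fun=> c) 0.
Proof. by split; exact: is_derive_cst. Qed.

Lemma cderive_real (f : R -> R) (df : R) : is_derive t 1 f df ->
  cderive t (fun x => (f x)%:C%C) (df%:C%C).
Proof. by move=> Df; split=> //=; exact: is_derive_cst. Qed.

Lemma cderiveD (f g : R -> R[i]) (df dg : R[i]) :
  cderive t f df -> cderive t g dg ->
  cderive t (fun x => f x + g x) (df + dg).
Proof.
move=> [f1 f2] [g1 g2]; split.
- by under eq_fun do rewrite ReD; rewrite ReD; exact: is_derive1D.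
- by under eq_fun do rewrite ImD; rewrite ImD; exact: is_derive1D.
Qed.

Lemma cderiveM (f g : R -> R[i]) (df dg : R[i]) :
  cderive t f df -> cderive t g dg ->
  cderive t (fun x => f x * g x) (df * g t + f t * dg).
Proof.
move=> [f1 f2] [g1 g2]; split.
- under eq_fun do rewrite ReM.
  have D1 : is_derive t 1 (fun=> - 1 : R) 0 by exact: is_derive_cst.
  have D := is_derive1D (is_derive1M f1 g1) (is_derive1M D1 (is_derive1M f2 g2)).
  by apply: (is_derive_eq D); rewrite ReD !ReM; ring.
- under eq_fun do rewrite ImM.
  apply: (is_derive_eq (is_derive1D (is_derive1M f1 g2) (is_derive1M f2 g1))).
  by rewrite ImD !ImM; ring.
Qed.

Lemma cderive_sum (I : Type) (r : seq I) (F : I -> R -> R[i]) (dF : I -> R[i]) :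
  (forall i, cderive t (F i) (dF i)) ->
  cderive t (fun x => \sum_(i <- r) F i x) (\sum_(i <- r) dF i).
Proof.
move=> DF; elim: r => [|i r IH].
  by under eq_fun do rewrite big_nil; rewrite big_nil; exact: cderive_cst.
by under eq_fun do rewrite big_cons; rewrite big_cons; exact: cderiveD.
Qed.

Lemma mx_is_derive_cst (m n : nat) (A : 'M[R[i]]_(m, n)) :
  mx_is_derive t (fun=> A) 0.
Proof. by move=> i j; rewrite mxE; exact: (cderive_cst (A i j)). Qed.

Lemma mx_is_deriveD (m n : nat) (F F' : R -> 'M[R[i]]_(m, n))
    (D D' : 'M[R[i]]_(m, n)) :
  mx_is_derive t F D -> mx_is_derive t F' D' ->
  mx_is_derive t (fun x => F x + F' x) (D + D').
Proof.
move=> DF DF' i j; suff: cderive t (fun x => (F x + F' x) i j) ((D + D') i j) by [].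
under eq_fun do rewrite mxE; rewrite mxE.
by apply: cderiveD; [exact: DF|exact: DF'].
Qed.

Lemma mx_is_deriveZ (m n : nat) (f : R -> R[i]) (F : R -> 'M[R[i]]_(m, n))
    (d : R[i]) (D : 'M[R[i]]_(m, n)) :
  cderive t f d -> mx_is_derive t F D ->
  mx_is_derive t (fun x => f x *: F x) (d *: F t + f t *: D).
Proof.
move=> Df DF i j.
suff: cderive t (fun x => (f x *: F x) i j) ((d *: F t + f t *: D) i j) by [].
under eq_fun do rewrite mxE; rewrite !mxE.
by apply: cderiveM => //; exact: DF.
Qed.

Lemma mx_is_deriveM (m n p : nat) (F : R -> 'M[R[i]]_(m, n))
    (F' : R -> 'M[R[i]]_(n, p)) (D : 'M[R[i]]_(m, n)) (D' : 'M[R[i]]_(n, p)) :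
  mx_is_derive t F D -> mx_is_derive t F' D' ->
  mx_is_derive t (fun x => F x *m F' x) (D *m F' t + F t *m D').
Proof.
move=> DF DF' i j.
suff: cderive t (fun x => (F x *m F' x) i j) ((D *m F' t + F t *m D') i j) by [].
under eq_fun do rewrite mxE; rewrite !mxE -big_split /=.
by apply: cderive_sum => k; apply: cderiveM; [exact: DF|exact: DF'].
Qed.

End ComplexDerivative.

(** * Linear systems with piecewise continuous coefficients *)

Lemma is_derive1_sum (R : realType) (I : Type) (r : seq I) (F : I -> R -> R)
    (dF : I -> R) (t : R) :
  (forall i, is_derive t 1 (F i) (dF i)) ->
  is_derive t 1 (fun x => \sum_(i <- r) F i x) (\sum_(i <- r) dF i).
Proof.
move=> DF; elim: r => [|i r IH].
  by under eq_fun do rewrite big_nil; rewrite big_nil; exact: is_derive_cst.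
by under eq_fun do rewrite big_cons; rewrite big_cons; exact: is_derive1D.
Qed.

Lemma within_continuous_sum (R : realType) (A : set R) (I : Type) (r : seq I)
    (F : I -> R -> R) :
  (forall i, {within A, continuous (F i)}) ->
  {within A, continuous (fun t => \sum_(i <- r) F i t)}.
Proof.
have [cst add _] := subalgebra_within A => cF; elim: r => [|i r IH].
  by under eq_fun do rewrite big_nil; exact: cst.
by under eq_fun do rewrite big_cons; apply: (add _ _ (cF i) IH).
Qed.

Lemma finite_exceptions (R : realType) (I : finType) (P : I -> R -> Prop) :
  (forall k, exists s : seq R, forall t, t \notin s -> P k t) ->
  exists s : seq R, forall t, t \notin s -> forall k, P k t.
Proof.
move=> /choice[s Ps]; exists (flatten [seq s k | k : I]) => t ts k.
apply: Ps; apply: contra ts => ts; apply/flattenP; exists (s k) => //.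
by apply: map_f; rewrite mem_enum.
Qed.

(* Gronwall's inequality for the squared Euclidean norm of the family [c]. *)
Lemma family_gronwall_eq0 (R : realType) (T K : R) (s : seq R) (I : finType)
    (c dc : I -> R -> R) : 0 <= K ->
  (forall k, {within `[0, T], continuous (c k)}) ->
  (forall t, t \in `]0, T[ -> t \notin s -> forall k,
    is_derive t 1 (c k) (dc k t) /\
    forall S, (forall l, `|c l t| <= S) -> `|dc k t| <= K * S) ->
  forall t, t \in `[0, T] -> (forall k, c k 0 = 0) <-> (forall k, c k t = 0).
Proof.
move=> K0 cc dcE t tT.
pose N t := \sum_k c k t * c k t.
pose dN t := \sum_k (dc k t * c k t + c k t * dc k t).
have N0 x : 0 <= N x by apply: sumr_ge0 => k _; rewrite -expr2 sqr_ge0.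
have NE x : (forall k, c k x = 0) <-> N x = 0.
  split=> [c0|/eqP]; first by rewrite /N big1// => k _; rewrite c0 mulr0.
  rewrite psumr_eq0 => [/allP c0 k|k _]; last by rewrite -expr2 sqr_ge0.
  by have := c0 k (mem_index_enum _); rewrite -expr2 sqrf_eq0 => /eqP.
(* The Euclidean norm bounds every component, so it can serve as [S] in the hypothesis on [dc]. *)
have cle x l : `|c l x| <= Num.sqrt (N x).
  rewrite -sqrtr_sqr ler_wsqrtr// /N (bigD1 l)//= -expr2 lerDl.
  by apply: sumr_ge0 => k _; rewrite -expr2 sqr_ge0.
have cN : {within `[0, T], continuous N}.
  by apply: within_continuous_sum => k; exact: within_continuousM.
(* Each component contributes two products to [dN], each at most [K * N] in absolute value. *)
rewrite !NE; apply: (@gronwall_eq0 R T (\sum_(k : I) (K + K)) s N dN cN N0) => //.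
move=> x xT xs; split.
  by apply: is_derive1_sum => k; have [D _] := dcE x xT xs k; exact: is_derive1M.
rewrite mulr_suml (le_trans (ler_norm_sum _ _ _))//; apply: ler_sum => k _.
have [_ /(_ _ (cle x)) dle] := dcE x xT xs k.
rewrite [c k x * _]mulrC (le_trans (ler_normD _ _))// mulrDl normrM.
have H : `|dc k x| * `|c k x| <= K * N x.
  apply: (le_trans (ler_pM _ _ dle (cle x k))) => //.
  by rewrite -mulrA -expr2 sqr_sqrtr.
exact: lerD.
Qed.

(** The equation X' = G X + B in the sense of [is_texp], with the initial value left free. When [G]
    is zero, [X] is an antiderivative of [B]. *)
Definition solves (R : realType) (m p : nat) (T : R) (G : R -> 'M[R[i]]_m)
    (B X : R -> 'M[R[i]]_(m, p)) : Prop :=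
  reim_entries (fun f => {within `[0, T], continuous f}) X /\
  exists s : seq R, forall t, t \in `]0, T[ -> t \notin s ->
    mx_is_derive t X (G t *m X t + B t).

Lemma mx_piecewise_continuous_bounded (R : realType) (a b : R) (m n : nat)
    (G : R -> 'M[R[i]]_(m, n)) :
  mx_piecewise_continuous a b G ->
  exists2 M, 0 <= M & forall t, t \in `[a, b] -> forall i j,
    `|complex.Re (G t i j)| <= M /\ `|complex.Im (G t i j)| <= M.
Proof.
move=> pG.
have /choice[M HM] : forall k : 'I_m * 'I_n, exists M, forall t, t \in `[a, b] ->
    `|complex.Re (G t k.1 k.2)| <= M /\ `|complex.Im (G t k.1 k.2)| <= M.
  move=> [i j] /=; have [p1 p2] := pG i j.
  have [M1 H1] := piecewise_continuous_bounded p1.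
  have [M2 H2] := piecewise_continuous_bounded p2.
  exists (Num.max M1 M2) => t tab.
  by rewrite !le_max H1// H2// orbT.
exists (\sum_k `|M k|) => [|t tab i j]; first exact: sumr_ge0.
have [H1 H2] := HM (i, j) t tab.
have le : M (i, j) <= \sum_k `|M k|.
  rewrite (bigD1 (i, j))//= (le_trans (ler_norm _))// lerDl; exact: sumr_ge0.
by split; apply: le_trans le.
Qed.

(** Gronwall applies to the finite family of real and imaginary parts of the entries. The direction
    from 0 to [t] yields uniqueness, the converse yields invertibility of [U]. *)
Lemma solves_eq0 (R : realType) (T : R) (m p : nat) (G : R -> 'M[R[i]]_m)
    (X : R -> 'M[R[i]]_(m, p)) :
  mx_piecewise_continuous 0 T G -> solves T G (fun=> 0) X ->
  forall t, t \in `[0, T] -> X 0 = 0 <-> X t = 0.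
Proof.
move=> pG [cX [s DX]] t tT.
have [M M0 GM] := mx_piecewise_continuous_bounded pG.
pose part (b : bool) (z : R[i]) := if b then complex.Re z else complex.Im z.
pose I : finType := ('I_m * 'I_p * bool)%type.
pose c (k : I) x := part k.2 (X x k.1.1 k.1.2).
pose dc (k : I) x := part k.2 ((G x *m X x) k.1.1 k.1.2).
have XE x : X x = 0 <-> forall k, c k x = 0.
  split=> [X0 [[i j] b]|c0]; first by rewrite /c /= X0 mxE; case: b.
  apply/matrixP => i j; rewrite mxE.
  have /= := c0 (i, j, true); have /= := c0 (i, j, false).
  by rewrite /c /=; case: (X x i j) => u v /= -> ->.
rewrite !XE.
(* An entry of [G x *m X x] is a sum of [m] complex products, and each part of such a product
   consists of two real products. *)
apply: (@family_gronwall_eq0 R T (\sum_(k < m) (M + M)) s I c dc) => //.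
- by apply: sumr_ge0 => k _; rewrite addr_ge0.
- by move=> [[i j] []]; have [] := cX i j.
move=> x xT xs [[i j] b]; split.
  by have := DX x xT xs i j; rewrite addr0; case: b => -[].
move=> S HS; rewrite /dc /= mxE mulr_suml.
have x01 : x \in `[0, T] by move: xT; rewrite !in_itv /= => /andP[/ltW-> /ltW->].
have GX k : `|part b (G x i k * X x k j)| <= (M + M) * S.
  have [G1 G2] := GM x x01 i k.
  have X1 : `|complex.Re (X x k j)| <= S by exact: (HS (k, j, true)).
  have X2 : `|complex.Im (X x k j)| <= S by exact: (HS (k, j, false)).
  rewrite mulrDl; case: b; rewrite /part.
    rewrite ReM (le_trans (ler_normD _ _))// mulN1r normrN !normrM.
    by apply: lerD; exact: ler_pM.
  rewrite ImM (le_trans (ler_normD _ _))// !normrM.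
  by apply: lerD; exact: ler_pM.
have -> : part b (\sum_j0 G x i j0 * X x j0 j) =
    \sum_j0 part b (G x i j0 * X x j0 j).
  by case: (b); rewrite /part ?Re_sum ?Im_sum.
by rewrite (le_trans (ler_norm_sum _ _ _))//; apply: ler_sum => k _.
Qed.

Lemma solves_unique (R : realType) (T : R) (m p : nat) (G : R -> 'M[R[i]]_m)
    (B B' X Y : R -> 'M[R[i]]_(m, p)) :
  mx_piecewise_continuous 0 T G -> {in `[0, T], B =1 B'} ->
  solves T G B X -> solves T G B' Y ->
  X 0 = Y 0 -> forall t, t \in `[0, T] -> X t = Y t.
Proof.
move=> pG BB' [cX [s DX]] [cY [s' DY]] XY0 t tT.
have algW := @subalgebra_within R `[0, T].
pose E x := X x + (- 1) *: Y x.
have E0 : E 0 = 0 by rewrite /E XY0 scaleN1r subrr.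
suff : E t = 0 by rewrite /E scaleN1r => /subr0_eq.
apply/(@solves_eq0 R T m p G E) => //; split.
  apply: reim_entriesD => //; apply: reim_entriesZ => //.
  exact: reim_cst.
exists (s ++ s') => x xT; rewrite mem_cat negb_or => /andP[xs xs'].
have DZ := mx_is_deriveD (DX x xT xs)
  (mx_is_deriveZ (cderive_cst x (- 1)) (DY x xT xs')).
have -> : G x *m E x + 0 =
    G x *m X x + B x + (0 *: Y x + -1 *: (G x *m Y x + B' x)).
  have x01 : x \in `[0, T] by move: xT; rewrite !in_itv /= => /andP[/ltW-> /ltW->].
  rewrite /E scale0r add0r addr0 !scaleN1r mulmxBr (BB' x x01).
  by rewrite opprD addrACA subrr addr0.
exact: DZ.
Qed.

(** If U(t) w = 0, then x -> U(x) w solves the homogeneous equation and vanishes at [t], hence also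
    at 0, where its value is w. *)
Lemma texp_unitmx (R : realType) (T : R) (m : nat) (G U : R -> 'M[R[i]]_m) :
  mx_piecewise_continuous 0 T G -> is_texp T G U ->
  forall t, t \in `[0, T] -> U t \in unitmx.
Proof.
move=> pG [cU U0 [s DU]] t tT.
have algW := @subalgebra_within R `[0, T].
(* [kermx] is a left kernel, so the transpose is taken to reach the column vectors killed by
   [U t]. *)
rewrite -unitmx_tr -row_free_unit -kermx_eq0; apply/eqP/row_matrixP => i.
set v := row i _; rewrite row0.
have Uv : U t *m v^T = 0.
  by apply: trmx_inj; rewrite trmx_mul trmxK trmx0 -row_mul mulmx_ker row0.
suff sol : solves T G (fun=> 0) (fun x => U x *m v^T).
  have [_ /(_ Uv)] := solves_eq0 pG sol tT.
  by rewrite U0 mul1mx => v0; apply: trmx_inj; rewrite trmx0.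
split.
  by apply: reim_entriesM => //; exact: reim_entries_cst.
exists s => x xT xs; rewrite addr0 mulmxA.
have := mx_is_deriveM (DU x xT xs) (mx_is_derive_cst x v^T).
by rewrite mulmx0 addr0.
Qed.

(** * Integrals of matrix functions as antiderivatives *)

Lemma mx_integral0 (R : realType) (m n : nat) (F : R -> 'M[R[i]]_(m, n)) :
  mx_integral 0 0 F = 0.
Proof.
by apply/matrixP => i j; rewrite !mxE /cintegral set_itv1 !Rintegral_set1.
Qed.

Lemma Re_mx_integral (R : realType) (a b : R) (m n : nat)
    (F : R -> 'M[R[i]]_(m, n)) i j :
  complex.Re (mx_integral a b F i j) =
  \int[lebesgue_measure]_(x in `[a, b]) complex.Re (F x i j).
Proof. by rewrite mxE. Qed.

Lemma Im_mx_integral (R : realType) (a b : R) (m n : nat)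
    (F : R -> 'M[R[i]]_(m, n)) i j :
  complex.Im (mx_integral a b F i j) =
  \int[lebesgue_measure]_(x in `[a, b]) complex.Im (F x i j).
Proof. by rewrite mxE. Qed.

Lemma mx_integral_solves (R : realType) (T : R) (m n : nat)
    (F : R -> 'M[R[i]]_(m, n)) : 0 < T ->
  mx_piecewise_continuous 0 T F ->
  solves T (fun=> 0) F (fun t => mx_integral 0 t F).
Proof.
move=> T0 pF; split=> [i j|].
  have [p1 p2] := pF i j.
  have [c1 _ _] := piecewise_continuous_FTC1 T0 p1.
  have [c2 _ _] := piecewise_continuous_FTC1 T0 p2.
  split.
  - have -> : (fun t => complex.Re (mx_integral 0 t F i j)) = _ :=
      funext (fun t => Re_mx_integral 0 t F i j).
    exact: c1.
  - have -> : (fun t => complex.Im (mx_integral 0 t F i j)) = _ :=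
      funext (fun t => Im_mx_integral 0 t F i j).
    exact: c2.
(* The exceptional points depend on the entry; finitely many finite sets are merged into one. *)
have [s Hs] : exists s : seq R, forall t, t \notin s -> forall k : 'I_m * 'I_n,
    t \in `]0, T[ -> cderive t (fun t => mx_integral 0 t F k.1 k.2) (F t k.1 k.2).
  apply: finite_exceptions => -[i j] /=; have [p1 p2] := pF i j.
  have [_ _ [s1 D1]] := piecewise_continuous_FTC1 T0 p1.
  have [_ _ [s2 D2]] := piecewise_continuous_FTC1 T0 p2.
  exists (s1 ++ s2) => t; rewrite mem_cat negb_or => /andP[ts1 ts2] tT.
  split.
  - under eq_fun do rewrite Re_mx_integral; exact: D1.
  - under eq_fun do rewrite Im_mx_integral; exact: D2.
exists s => t tT ts i j; rewrite mul0mx add0r.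
exact: (Hs t ts (i, j) tT).
Qed.

Lemma eq_mx_integral (R : realType) (a b : R) (m n : nat)
    (F F' : R -> 'M[R[i]]_(m, n)) :
  {in `[a, b], F =1 F'} -> mx_integral a b F = mx_integral a b F'.
Proof.
move=> FF'; apply/matrixP => i j; rewrite !mxE /cintegral.
by congr Complex; apply: eq_Rintegral => x; rewrite inE /= => xab; rewrite FF'.
Qed.

(** * The last block column *)

(** Both sides are antiderivatives of [C *m F t] vanishing at 0, so uniqueness identifies them. *)
Lemma mx_integralMl (R : realType) (T : R) (m n p : nat)
    (C : 'M[R[i]]_(m, n)) (F : R -> 'M[R[i]]_(n, p)) : 0 < T ->
  mx_piecewise_continuous 0 T F ->
  forall x, x \in `[0, T] ->
  mx_integral 0 x (fun t => C *m F t) = C *m mx_integral 0 x F.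
Proof.
move=> T0 pF x xT.
have algP := @subalgebra_piecewise R 0 T.
have algW := @subalgebra_within R `[0, T].
have pCF : mx_piecewise_continuous 0 T (fun t => C *m F t).
  by apply: reim_entriesM => //; exact: reim_entries_cst.
have [cF [s DF]] := mx_integral_solves T0 pF.
apply: (@solves_unique R T m p (fun=> 0) (fun t => C *m F t) (fun t => C *m F t)
  (fun t => mx_integral 0 t (fun t => C *m F t))
  (fun t => C *m mx_integral 0 t F)) => //.
- exact: reim_entries_cst.
- exact: mx_integral_solves.
- split; first by apply: reim_entriesM => //; exact: reim_entries_cst.
  exists s => t tT ts.
  have := mx_is_deriveM (mx_is_derive_cst t C) (DF t tT ts).
  by rewrite !mul0mx !add0r.
- by rewrite !mx_integral0 mulmx0.
Qed.

Lemma is_derive1_exp (R : realType) (t : R) (d : nat) :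
  is_derive t 1 (fun x : R => x ^+ d) (d%:R * t ^+ d.-1).
Proof.
have := is_deriveX d (is_derive_id t (1 : R)).
have -> : (id : R -> R) ^+ d = (fun x : R => x ^+ d).
  by elim: d => [|d IH]; apply/funext => x; rewrite ?expr0// !exprS IH.
by rewrite /GRing.scale /= mulr1.
Qed.

(** The product rule. In the triangular system its first term matches the off-diagonal coefficient
    [d] times the block with exponent d - 1. *)
Lemma solves_scale_exp (R : realType) (T : R) (m p d : nat)
    (B Y : R -> 'M[R[i]]_(m, p)) :
  solves T (fun=> 0) B Y ->
  solves T (fun=> 0)
    (fun t => (d%:R * (t ^+ d.-1)%:C%C) *: Y t + (t ^+ d)%:C%C *: B t)
    (fun t => (t ^+ d)%:C%C *: Y t).
Proof.
move=> [cY [s DY]]; have algW := @subalgebra_within R `[0, T]; split.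
  apply: reim_entriesZ => //; apply: reim_real => //.
  by apply: continuous_subspaceT => x; exact: exprn_continuous.
exists s => t tT ts.
have := mx_is_deriveZ (cderive_real (is_derive1_exp t d)) (DY t tT ts).
by rewrite rmorphM rmorph_nat !mul0mx !add0r.
Qed.

(** Variation of constants: (U Y)' = G U Y + U B whenever Y' = B. *)
Lemma solves_texp_mul (R : realType) (T : R) (m p : nat) (G U : R -> 'M[R[i]]_m)
    (B Y : R -> 'M[R[i]]_(m, p)) :
  is_texp T G U -> solves T (fun=> 0) B Y ->
  solves T G (fun t => U t *m B t) (fun t => U t *m Y t).
Proof.
move=> [cU _ [s DU]] [cY [s' DY]]; have algW := @subalgebra_within R `[0, T].
split; first exact: reim_entriesM.
exists (s ++ s') => t tT; rewrite mem_cat negb_or => /andP[ts ts'].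
have := mx_is_deriveM (DU t tT ts) (DY t tT ts').
by rewrite mul0mx add0r mulmxA.
Qed.

Lemma solves_cst (R : realType) (T : R) (m p : nat) (A : 'M[R[i]]_(m, p)) :
  solves T (fun=> 0) (fun=> 0) (fun=> A).
Proof.
split; first by apply: reim_entries_cst; exact: subalgebra_within.
by exists [::] => t _ _; rewrite mul0mx addr0; exact: mx_is_derive_cst.
Qed.

Lemma nth_offdiag_coefs_low (s1 s2 m : nat) : (m <= s1)%N ->
  nth 0%N (offdiag_coefs s1 s2) m = 0%N.
Proof.
by move=> ms; rewrite /offdiag_coefs nth_cat size_nseq ltnS ms nth_nseq ltnS ms.
Qed.

Lemma nth_offdiag_coefs_mid (s1 s2 d : nat) : (d <= s1)%N ->
  nth 0%N (offdiag_coefs s1 s2) (s1 + s1.+1 - d) = d.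
Proof.
move=> ds; rewrite /offdiag_coefs nth_cat size_nseq ifF; last lia.
rewrite nth_cat size_rev size_iota ifT; last lia.
rewrite nth_rev size_iota; last lia.
by rewrite nth_iota; lia.
Qed.

Lemma nth_offdiag_coefs_high (s1 s2 d : nat) : (d <= s1 + s2)%N ->
  nth 0%N (offdiag_coefs s1 s2) (3 * s1 + s2 + 2 - d) = d.
Proof.
move=> ds; rewrite /offdiag_coefs nth_cat size_nseq ifF; last lia.
rewrite nth_cat size_rev size_iota ifF; last lia.
(* For [d] = 0 the index is one past the end of the list, and the default value 0 is the expected
   one. *)
have [->|d0] := eqVneq d 0%N.
  by rewrite nth_default// size_rev size_iota; lia.
rewrite nth_rev size_iota; last lia.
by rewrite nth_iota; lia.
Qed.

Section LastColumn.
Variables (R : realType) (T : R) (n s1 s2 : nat).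
Variables (G A1 A2 : R -> 'M[R[i]]_n) (U : R -> 'M[R[i]]_n).
Variable V : R -> 'M[R[i]]_(\sum_(i < nblocks s1 s2) n).
Hypothesis T_gt0 : 0 < T.
Hypothesis pG : mx_piecewise_continuous 0 T G.
Hypothesis texpU : is_texp T G U.
Hypothesis texpV : is_texp T (L_gen s1 s2 G A1 A2) V.

(* [inord] sends an out-of-range [j] to block 0; such indices only occur with
   zero coefficients. *)
Definition last_col (j : nat) (t : R) : 'M[R[i]]_n :=
  @submxblock R[i] (nblocks s1 s2) (nblocks s1 s2) (fun=> n) (fun=> n)
    (V t) (inord j) ord_max.

(** The off-diagonal part of row [j]; it involves only lower blocks, already known when the system
    is solved from the bottom up. *)
Definition L_forcing (j : nat) (t : R) : 'M[R[i]]_n :=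
  (nth 0%N (offdiag_coefs s1 s2) j)%:R *: last_col j.+1 t
  + nth 0 (nseq s1.+1 (A1 t) ++ nseq s1.+1 (A2 t)) j *m last_col (j + s1.+1) t.

(** When [k] is out of range the sum is empty of nonzero terms, while [inord k] is a default index;
    the hypothesis on [C] makes both sides 0. *)
Lemma sum_block_pick (p : nat) (k : nat) (C : 'M[R[i]]_n)
    (X : 'I_p.+1 -> 'M[R[i]]_n) : ((p < k)%N -> C = 0) ->
  \sum_(l < p.+1) (if l == k :> nat then C else 0) *m X l = C *m X (inord k).
Proof.
move=> C0; have [kp|pk] := leqP k p; last first.
  by rewrite C0// mul0mx big1// => l _; rewrite if_same mul0mx.
rewrite (bigD1 (inord k))//= inordK// eqxx big1 ?addr0// => l.
by rewrite -val_eqE /= inordK// => /negbTE ->; rewrite mul0mx.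
Qed.

Lemma last_col_solves (j : nat) : (j < nblocks s1 s2)%N ->
  solves T G (L_forcing j) (last_col j).
Proof.
move=> jN; have [cV _ [s DV]] := texpV.
pose r a : 'I_(\sum_(i < nblocks s1 s2) n) :=
  tagnat.Rank (inord j : 'I_(nblocks s1 s2)) a.
pose c b : 'I_(\sum_(i < nblocks s1 s2) n) :=
  tagnat.Rank (ord_max : 'I_(nblocks s1 s2)) b.
have colE a b : (fun t => last_col j t a b) = fun t => V t (r a) (c b).
  by apply/funext => t; rewrite !mxE.
split=> [a b|].
  suff : reim (fun f => {within `[0, T], continuous f})
    (fun t => last_col j t a b) by [].
  by rewrite colE; exact: cV.
exists s => t tT ts.
suff -> : G t *m last_col j t + L_forcing j t =
    @submxblock R[i] (nblocks s1 s2) (nblocks s1 s2) (fun=> n) (fun=> n)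
      (L_gen s1 s2 G A1 A2 t *m V t) (inord j) ord_max.
  move=> a b; set D := submxblock _ _ _.
  suff : cderive t (fun t => last_col j t a b) (D a b) by [].
  by rewrite colE /D /submxblock mxE; exact: DV.
(* With [V t] cut into blocks the product is computed blockwise, and each of the three contributions
   to [L_block] picks one block. *)
rewrite -[V t in RHS]submxblockK /L_gen mul_mxblock mxblockK /L_block.
under eq_bigr do rewrite 2!mulmxDl.
rewrite 2!big_split /= !sum_block_pick inordK//.
- by rewrite mul_scalar_mx -addrA.
(* If j + s1 + 1 exceeds the last index 3 s1 + s2 + 2, then j is at least 2 s1 + 2, the length of
   the list of matrices. *)
- by move=> h; rewrite nth_default //= size_cat /= !size_nseq; lia.
- move=> h; rewrite nth_default ?raddf0//.
  by rewrite /offdiag_coefs !size_cat size_nseq !size_rev !size_iota; lia.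
- by rewrite ltnNge -ltnS jN.
Qed.

Lemma last_col0 (j : nat) : (j < nblocks s1 s2)%N ->
  last_col j 0 = (j == 3 * s1 + s2 + 2)%N%:R%:M.
Proof.
move=> jN; have [_ V0 _] := texpV.
rewrite /last_col V0 -mxdiagZ /mxdiag mxblockK -val_eqE /= inordK//.
by case: eqP => // _; rewrite ?conform_mx_id// raddf0.
Qed.

(** By uniqueness, a candidate U Y for a block is verified through its forcing term and its initial
    value alone. *)
Lemma last_col_eq (j : nat) (B Y : R -> 'M[R[i]]_n) : (j < nblocks s1 s2)%N ->
  solves T (fun=> 0) B Y ->
  (forall t, t \in `[0, T] -> L_forcing j t = U t *m B t) ->
  last_col j 0 = Y 0 ->
  forall t, t \in `[0, T] -> last_col j t = U t *m Y t.
Proof.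
move=> jN sY LB XY t tT.
apply: (solves_unique pG LB (last_col_solves jN) (solves_texp_mul texpU sY)) => //.
by have [_ -> _] := texpU; rewrite mul1mx.
Qed.

(** These blocks have index at least 2 s1 + 2, past the rows containing [A1] or [A2]. Only the
    coefficient [d] acts, and it integrates t^(d-1) to t^d. *)
Lemma last_col_high (d : nat) (t : R) : (d <= s1 + s2)%N -> t \in `[0, T] ->
  last_col (3 * s1 + s2 + 2 - d) t = (t ^+ d)%:C%C *: U t.
Proof.
elim: d t => [|d IH] t ds tT; rewrite -[U t]mulmx1 scalemxAr.
  apply: (last_col_eq _ (solves_scale_exp 0 (solves_cst T 1%:M))) => //.
  - by rewrite ltnS leq_subr.
  (* In the last row both coefficients vanish, so the out-of-range blocks in [L_forcing] are
     harmless. *)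
  - move=> x xT; rewrite /L_forcing nth_offdiag_coefs_high//.
    rewrite nth_default ?size_cat ?size_nseq; last lia.
    by rewrite !(scale0r, mul0mx, mulmx0, mul0r, scaler0, addr0).
  - by rewrite last_col0 ?subn0 ?eqxx ?expr0 ?scale1r.
apply: (last_col_eq _ (solves_scale_exp d.+1 (solves_cst T 1%:M))) => //.
- by rewrite ltnS leq_subr.
- move=> x xT; rewrite /L_forcing nth_offdiag_coefs_high//.
  rewrite nth_default ?size_cat ?size_nseq; last lia.
  rewrite mul0mx addr0 scaler0 addr0 -scalemxAr mulmx1.
  have -> : (3 * s1 + s2 + 2 - d.+1).+1 = (3 * s1 + s2 + 2 - d)%N by lia.
  by rewrite (IH _ (ltnW ds) xT) scalerA.
- rewrite last_col0 ?ltnS ?leq_subr// exprS mul0r scale0r.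
  by rewrite [_ == _](_ : _ = false) ?raddf0//; lia.
Qed.

Hypothesis pA1 : mx_piecewise_continuous 0 T A1.
Hypothesis pA2 : mx_piecewise_continuous 0 T A2.

Definition interaction (s : nat) (A : R -> 'M[R[i]]_n) (t : R) : 'M[R[i]]_n :=
  (t ^+ s)%:C%C *: (invmx (U t) *m A t *m U t).

Lemma interaction_piecewise (s : nat) (A : R -> 'M[R[i]]_n) :
  mx_piecewise_continuous 0 T A ->
  mx_piecewise_continuous 0 T (interaction s A).
Proof.
move=> pA; have algP := @subalgebra_piecewise R 0 T.
have [cU _ _] := texpU.
have pw (F : R -> 'M[R[i]]_n) :
    reim_entries (fun f => {within `[0, T], continuous f}) F ->
    mx_piecewise_continuous 0 T F.
  by move=> cF i j; have [c1 c2] := cF i j; split; exact: within_continuous_piecewise.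
apply: reim_entriesZ => //.
  apply: reim_real => //; apply: within_continuous_piecewise => //.
  by apply: continuous_subspaceT => x; exact: exprn_continuous.
apply: reim_entriesM => //; last exact: pw.
apply: reim_entriesM => //; apply/pw/reim_entries_within_invmx => //.
exact: texp_unitmx pG texpU.
Qed.

Lemma mul_interaction (s : nat) (A : R -> 'M[R[i]]_n) (t : R) :
  t \in `[0, T] ->
  U t *m interaction s A t = (t ^+ s)%:C%C *: (A t *m U t).
Proof.
move=> tT; rewrite /interaction -scalemxAr !mulmxA mulmxV ?mul1mx//.
exact: texp_unitmx pG texpU t tT.
Qed.

Let I2 t := mx_integral 0 t (interaction s2 A2).

(** These rows contain [A2], which multiplies the block t^(d+s2) U and so supplies t^d times the
    derivative of [I2]. The coefficient [d] supplies the other term of the product rule. *)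
Lemma last_col_mid (d : nat) (t : R) : (d <= s1)%N -> t \in `[0, T] ->
  last_col (s1 + s1.+1 - d) t = (t ^+ d)%:C%C *: (U t *m I2 t).
Proof.
have sI2 := mx_integral_solves T_gt0 (interaction_piecewise s2 pA2).
have forcingA2 e x : (e <= s1)%N -> x \in `[0, T] ->
    nth 0 (nseq s1.+1 (A1 x) ++ nseq s1.+1 (A2 x)) (s1 + s1.+1 - e) *m
      last_col (s1 + s1.+1 - e + s1.+1) x =
    U x *m ((x ^+ e)%:C%C *: interaction s2 A2 x).
  move=> es xT; rewrite nth_cat size_nseq ifF; last lia.
  rewrite nth_nseq ifT; last lia.
  have -> : (s1 + s1.+1 - e + s1.+1 = 3 * s1 + s2 + 2 - (e + s2))%N by lia.
  rewrite last_col_high//; last lia.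
  by rewrite -[RHS]scalemxAr mul_interaction// scalerA -rmorphM -exprD -scalemxAr.
have initial e : (e <= s1)%N -> last_col (s1 + s1.+1 - e) 0 = 0.
  move=> es; rewrite last_col0; last by rewrite /nblocks; lia.
  by rewrite [_ == _](_ : _ = false) ?raddf0//; lia.
elim: d t => [|d IH] t ds tT; rewrite scalemxAr.
- apply: (last_col_eq _ (solves_scale_exp 0 sI2)) => //.
  + by rewrite /nblocks; lia.
  (* The decreasing run s1, ..., 0 ends with 0, which decouples this row from the block just below
     it. *)
  + move=> x xT; rewrite /L_forcing nth_offdiag_coefs_mid// forcingA2//.
    by rewrite scale0r mul0r scale0r !add0r.
  + by rewrite initial// mx_integral0 scaler0.
- apply: (last_col_eq _ (solves_scale_exp d.+1 sI2)) => //.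
  + by rewrite /nblocks; lia.
  + move=> x xT; rewrite /L_forcing nth_offdiag_coefs_mid// forcingA2//.
    rewrite mulmxDr -[in RHS]scalemxAr -scalerA.
    have -> : ((s1 + s1.+1 - d.+1).+1 = s1 + s1.+1 - d)%N by lia.
    by rewrite (IH _ (ltnW ds) xT).
  + by rewrite initial// mx_integral0 scaler0.
Qed.

(** Row 0 has off-diagonal coefficient 0, so its only source is [A1] times block s1 + 1, which is
    t^s1 U I2 by the case d = s1 of [last_col_mid]. *)
Lemma first_col_last (t : R) : t \in `[0, T] ->
  last_col 0 t =
  U t *m mx_integral 0 t (fun t1 => interaction s1 A1 t1 *m I2 t1).
Proof.
move=> tT.
have [cI2 _] := mx_integral_solves T_gt0 (interaction_piecewise s2 pA2).
have pI : mx_piecewise_continuous 0 T (fun t1 => interaction s1 A1 t1 *m I2 t1).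
  apply: reim_entriesM; [exact: subalgebra_piecewise|exact: interaction_piecewise|].
  by move=> i j; have [c1 c2] := cI2 i j; split; exact: within_continuous_piecewise.
apply: (last_col_eq _ (mx_integral_solves T_gt0 pI)) => //.
- move=> x xT; rewrite /L_forcing nth_offdiag_coefs_low// scale0r add0r /= add0n.
  have -> : s1.+1 = (s1 + s1.+1 - s1)%N by lia.
  rewrite last_col_mid// mulmxA mul_interaction//.
  by rewrite -scalemxAr -scalemxAl mulmxA.
- by rewrite mx_integral0 last_col0// [_ == _](_ : _ = false) ?raddf0//; lia.
Qed.

End LastColumn.

Theorem mainTheorem4 (R : realType) (T : R) (hT : 0 < T)
    (n : nat) (hn : (1 <= n)%N) (s1 s2 : nat)
    (G A1 A2 : R -> 'M[R[i]]_n)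
    (hG : mx_piecewise_continuous 0 T G)
    (hA1 : mx_piecewise_continuous 0 T A1)
    (hA2 : mx_piecewise_continuous 0 T A2)
    (U : R -> 'M[R[i]]_n) (hU : is_texp T G U)
    (V : R -> 'M[R[i]]_(\sum_(i < nblocks s1 s2) n))
    (hV : is_texp T (L_gen s1 s2 G A1 A2) V)
    (t : R) (ht : t \in `[0, T]) :
  @submxblock R[i] (nblocks s1 s2) (nblocks s1 s2) (fun=> n) (fun=> n)
    (V t) ord0 ord_max =
  U t *m
    mx_integral 0 t (fun t1 =>
      mx_integral 0 t1 (fun t2 =>
        (t1 ^+ s1 * t2 ^+ s2)%:C%C *:
          (invmx (U t1) *m A1 t1 *m U t1 *m (invmx (U t2) *m A2 t2 *m U t2)))).
Proof.
have := first_col_last hT hG hU hV hA1 hA2 ht; rewrite /last_col.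
have -> : inord 0 = ord0 :> 'I_(nblocks s1 s2) by apply/val_inj; rewrite /= inordK.
move=> ->; congr (_ *m _); apply: eq_mx_integral => t1 t1t.
have t1T : t1 \in `[0, T].
  move: t1t ht; rewrite !in_itv /= => /andP[-> t1t] /andP[_ tT].
  exact: le_trans tT.
(* The factor depending on [t1] is constant for the inner integral and moves under it. *)
rewrite -(mx_integralMl _ hT (interaction_piecewise hT hG hU s2 hA2) t1T).
apply: eq_mx_integral => t2 _.
by rewrite /interaction -scalemxAl -scalemxAr scalerA rmorphM.
Qed.
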